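(* Let $n$ be a natural number, $H=\{1,\dots,n\}\times\mathbb{N}$ with $\mathbb{N}=\{1,2,\dots\}$, and let $D=(D_{am,bk})$, $G=(G_{am,bk})$ (indices $(a,m),(b,k)\in H$) be complex matrices such that $D$ has an inverse $D^{-1}$ and $GD^{-1}$ is well-defined. Let $(\mathcal{Q}^{(a)}_m(y))_{(a,m)\in H}$ be the canonical solution of the specialized $Q$-system in $y=(y_a)_{a=1}^n$ $$\prod_{(b,k)\in H}(\mathcal{Q}^{(b)}_k(y))^{D_{am,bk}}+(y_a)^m\prod_{(b,k)\in H}(\mathcal{Q}^{(b)}_k(y))^{G_{am,bk}}=1\qquad((a,m)\in H).$$ For $\nu\in\boldsymbol\nu(D)$ let $\mathcal{Q}^\nu_{D,G}(y)=\prod_{(a,m)\in H}(\mathcal{Q}^{(a)}_m(y))^{\nu^{(a)}_m}$. Then $$\mathcal{Q}^\nu_{D,G}(y)=\mathcal{K}^\nu_{D,G}(y)/\mathcal{K}^0_{D,G}(y)=\mathcal{R}^\nu_{D,G}(y),$$ where $\boldsymbol\nu(D)$ and the power series $\mathcal K^\nu_{D,G}(y)$, $\mathcal R^\nu_{D,G}(y)$ are defined in the context.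
   Context: Products of infinite matrices are well-defined when each entry is a sum with all but finitely many terms zero; this is required of $DD^{-1}=D^{-1}D=I$ and $GD^{-1}$. The inverse $D^{-1}$ is fixed. In $\mathbb{C}[[y]]$ (standard adic topology), $f^\alpha$ for $f$ with constant term $1$ and $\alpha\in\mathbb{C}$ is the $\alpha$-th power with constant term $1$; infinite products are required to converge irrespective of the order of factors. Solutions are families of power series with constant terms $1$. A solution is canonical if for all $(a,m)\in H$, $\prod_{(b,k)\in H}\{\prod_{(c,j)\in H}(\mathcal{Q}^{(c)}_j(y))^{(D^{-1})_{am,bk}D_{bk,cj}}\}=\mathcal{Q}^{(a)}_m(y)$; the canonical solution exists and is unique. $\boldsymbol\nu(D)$ is the set of $\nu=(\nu^{(a)}_m)_{(a,m)\in H}$, $\nu^{(a)}_m\in\mathbb{C}$, such that for each $(b,k)\in H$ all but finitely many $\nu^{(a)}_m(D^{-1})_{am,bk}$ are zero. $\binom{a}{b}=\frac{\Gamma(a+1)}{\Gamma(a-b+1)\Gamma(b+1)}$ for $a\in\mathbb{C}$, $b\in\mathbb{Z}_{\ge0}$ (limit value at singularities). Let $\mathcal N$ be the set of $N=(N_i)_{i\in H}$ with $N_i\in\mathbb{Z}_{\ge0}$, all but finitely many zero (for $i=(a,m)$ write $N_i=N^{(a)}_m$, $\nu_i=\nu^{(a)}_m$), and $H(N)=\{i\in H\mid N_i\neq0\}$. Put $$P_i=-\sum_{j\in H}\nu_j(D^{-1})_{ji}-\sum_{j\in H}N_j(GD^{-1})_{ji},\qquad F_{ij}=\delta_{ij}P_j+(GD^{-1})_{ij}N_j,$$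 $$\mathcal{K}^\nu_{D,G}(y)=\sum_{N\in\mathcal N}\Bigl(\prod_{i\in H(N)}\binom{P_i+N_i}{N_i}\Bigr)\prod_{(a,m)\in H}(y_a)^{mN^{(a)}_m},$$ $$\mathcal{R}^\nu_{D,G}(y)=\sum_{N\in\mathcal N}\Bigl(\det_{i,j\in H(N)}F_{ij}\Bigr)\Bigl(\prod_{i\in H(N)}\frac1{N_i}\binom{P_i+N_i-1}{N_i-1}\Bigr)\prod_{(a,m)\in H}(y_a)^{mN^{(a)}_m},$$ with empty determinants and products equal to $1$. *)

(* Defs.v *)
From HB Require Import structures.
From mathcomp Require Import all_boot all_order all_algebra.
From mathcomp Require Import finmap mpoly complex.
From mathcomp Require Import boolp classical_sets functions cardinality fsbigop.
From mathcomp Require Import reals.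

Set Implicit Arguments.
Unset Strict Implicit.
Unset Printing Implicit Defensive.

Import Order.TTheory GRing.Theory Num.Theory.

Local Open Scope ring_scope.
Local Open Scope classical_set_scope.

(* Formal power series in n variables with coefficients in K; [f m] is the
   coefficient of the monomial m. *)
Record fps (K : comNzRingType) (n : nat) := FPS { coef :> 'X_{1..n} -> K }.

Section FpsRing.
Variables (K : comNzRingType) (n : nat).
Local Notation fps := (fps K n).
Implicit Types (f g h : fps) (m : 'X_{1..n}).

Lemma fpsP f g : (forall m, f m = g m) -> f = g.
Proof. by case: f g => [f] [g] /= /funext ->. Qed.

HB.instance Definition _ := gen_eqMixin fps.
HB.instance Definition _ := gen_choiceMixin fps.

Definition fps_zero : fps := FPS (fun=> 0).
Definition fps_opp f : fps := FPS (fun m => - f m).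
Definition fps_add f g : fps := FPS (fun m => f m + g m).

Lemma fps_addA : associative fps_add.
Proof. by move=> f g h; apply/fpsP => m /=; rewrite addrA. Qed.
Lemma fps_addC : commutative fps_add.
Proof. by move=> f g; apply/fpsP => m /=; rewrite addrC. Qed.
Lemma fps_add0 : left_id fps_zero fps_add.
Proof. by move=> f; apply/fpsP => m /=; rewrite add0r. Qed.
Lemma fps_addN : left_inverse fps_zero fps_opp fps_add.
Proof. by move=> f; apply/fpsP => m /=; rewrite addNr. Qed.

HB.instance Definition _ :=
  GRing.isZmodule.Build fps fps_addA fps_addC fps_add0 fps_addN.

Definition fpsC (c : K) : fps := FPS (fun m => if m == 0%MM then c else 0).

Definition fps_mul f g : fps :=
  FPS (fun m => \sum_(k : 'X_{1..n < (mdeg m).+1, (mdeg m).+1}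
                       | m == (k.1 + k.2)%MM) f k.1 * g k.2).

Definition fps_trunc d f : {mpoly K[n]} :=
  \sum_(m : 'X_{1..n < d}) f m *: 'X_[m].

Lemma fps_truncE d f m : (mdeg m < d)%N -> (fps_trunc d f)@_m = f m.
Proof. exact: mcoeff_mpoly. Qed.

Lemma fps_mulE d f g (p q : {mpoly K[n]}) :
    (forall m, (mdeg m < d)%N -> p@_m = f m) ->
    (forall m, (mdeg m < d)%N -> q@_m = g m) ->
  forall m, (mdeg m < d)%N -> (p * q)@_m = fps_mul f g m.
Proof.
move=> pf qg m md; rewrite [LHS](mcoeff_poly_mul p q (ltnSn (mdeg m))) /=.
apply: eq_bigr => -[[k1 lt1] [k2 lt2]] /= /eqP mE.
by rewrite pf ?qg //; apply: leq_ltn_trans md; rewrite mE mdegD ?leq_addl ?leq_addr.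
Qed.

Lemma fps_mulA : associative fps_mul.
Proof.
move=> f g h; apply/fpsP => m; pose d := (mdeg m).+1.
have T (e : fps) := @fps_truncE d e.
have fgE := fps_mulE (T f) (T g); have ghE := fps_mulE (T g) (T h).
rewrite -(fps_mulE (T f) ghE (ltnSn _)) -(fps_mulE fgE (T h) (ltnSn _)).
by rewrite mulrA.
Qed.

Lemma fps_mulC : commutative fps_mul.
Proof.
move=> f g; apply/fpsP => m; pose d := (mdeg m).+1.
have T (e : fps) := @fps_truncE d e.
rewrite -(fps_mulE (T f) (T g) (ltnSn _)) -(fps_mulE (T g) (T f) (ltnSn _)).
by rewrite mulrC.
Qed.

Lemma fps_mul1 : left_id (fpsC 1) fps_mul.
Proof.
move=> f; apply/fpsP => m; pose d := (mdeg m).+1.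
have T (e : fps) := @fps_truncE d e.
have one m' : (mdeg m' < d)%N -> (1 : {mpoly K[n]})@_m' = fpsC 1 m'.
  by move=> _; rewrite mcoeff1 /=; case: eqP.
by rewrite -(fps_mulE one (T f) (ltnSn _)) mul1r fps_truncE.
Qed.

Lemma fps_mulD : left_distributive fps_mul fps_add.
Proof.
move=> f g h; apply/fpsP => m /=; rewrite -big_split /=.
by apply: eq_bigr => k _; rewrite mulrDl.
Qed.

Lemma fps_one_neq0 : fpsC 1 != 0 :> fps.
Proof.
apply/eqP => /(congr1 (fun f : fps => f 0%MM)) /= /eqP.
by rewrite eqxx oner_eq0.
Qed.

HB.instance Definition _ := GRing.Zmodule_isComNzRing.Build fps
  fps_mulA fps_mulC fps_mul1 fps_mulD fps_one_neq0.

Definition fps_unit : pred fps := fun f => `[< exists g, g * f = 1 >].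
Definition fps_inv f : fps := xget f [set g | g * f = 1].

Lemma fps_mulV : {in fps_unit, left_inverse 1 fps_inv *%R}.
Proof.
move=> f /asboolP [g gf]; rewrite /fps_inv; case: xgetP => [h _ //|].
by move=> /(_ g)/(_ gf).
Qed.
Lemma fps_intro_unit f g : g * f = 1 -> fps_unit f.
Proof. by move=> gf; apply/asboolP; exists g. Qed.
Lemma fps_inv_out : {in [predC fps_unit], fps_inv =1 id}.
Proof.
move=> f /negP fNU; rewrite /fps_inv; case: xgetP => // g _ gf.
by case: fNU; apply/asboolP; exists g.
Qed.

HB.instance Definition _ := GRing.ComNzRing_hasMulInverse.Build fps
  fps_mulV fps_intro_unit fps_inv_out.

Definition fpsX (a : 'I_n) : fps := FPS (fun m => (m == U_(a)%MM)%:R).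

(* Sum of a family, coefficient by coefficient.  For every family summed below
   only finitely many members contribute to a given coefficient; otherwise
   [\sum_(i \in _)] would return 0. *)
Definition isum (I : choiceType) (f : I -> fps) : fps :=
  FPS (fun m => \sum_(i \in [set: I]) f i m).

(* Congruence modulo the d-th power of the ideal generated by the variables. *)
Definition fps_eqmod (d : nat) f g := forall m, (mdeg m < d)%N -> f m = g m.

(* [iprod_to f P]: the product of the family f converges to P, irrespective of
   the order of the factors, for the adic topology. *)
Definition iprod_to (I : choiceType) (f : I -> fps) (P : fps) :=
  forall d, exists S : {fset I}, forall T : {fset I},
    (S `<=` T)%fset -> fps_eqmod d (\prod_(i <- T) f i) P.

Definition iprod_cvg (I : choiceType) (f : I -> fps) := exists P, iprod_to f P.

Definition iprod (I : choiceType) (f : I -> fps) : fps :=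
  xget 1 [set P | iprod_to f P].

Lemma iprod_unique (I : choiceType) (f : I -> fps) P P' :
  iprod_to f P -> iprod_to f P' -> P = P'.
Proof.
move=> fP fP'; apply/fpsP => m.
have [S SP] := fP (mdeg m).+1; have [S' SP'] := fP' (mdeg m).+1.
rewrite -(SP (S `|` S')%fset) ?fsubsetUl //.
by rewrite -(SP' (S `|` S')%fset) ?fsubsetUr.
Qed.

Lemma iprodE (I : choiceType) (f : I -> fps) P : iprod_to f P -> iprod f = P.
Proof.
move=> fP; rewrite /iprod; case: xgetP => [Q _ fQ|/(_ P)//].
exact: iprod_unique fQ fP.
Qed.

End FpsRing.

Section Binomial.
Variable K : numFieldType.

(* Generalized binomial coefficient a (a - 1) ... (a - b + 1) / b!. *)
Definition cbinom (a : K) (b : nat) : K :=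
  \prod_(i < b) (a - i%:R) / (b`!)%:R.

(* At regular points [cbinom] is the quotient of Gamma values, for any Gam that
   satisfies the functional equation of the Gamma function off its poles; being
   polynomial in a, it is also the limit of that quotient at the other points. *)
Lemma cbinom_Gamma (Gam : K -> K) (a : K) (b : nat) :
    let regular z := forall k : nat, z != - k%:R in
    Gam 1 = 1 ->
    (forall z, regular z -> Gam z != 0) ->
    (forall z, regular z -> Gam (z + 1) = z * Gam z) ->
    regular (a - b%:R + 1) ->
  cbinom a b = Gam (a + 1) / (Gam (a - b%:R + 1) * Gam (b%:R + 1)).
Proof.
move=> regular G1 Gn0 GS areg.
have Gfact c : Gam (c%:R + 1) = (c`!)%:R.
  elim: c => [|c IH]; first by rewrite add0r G1.
  rewrite -natr1 GS ?IH; first by rewrite natr1 factS natrM.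
  by move=> k; rewrite -addr_eq0 natr1 -natrD pnatr_eq0.
have step z : regular z -> Gam (z + b%:R) = \prod_(i < b) (z + i%:R) * Gam z.
  move=> zreg; elim: b {areg} => [|c IH]; first by rewrite addr0 big_ord0 mul1r.
  rewrite -natr1 addrA GS ?IH ?big_ord_recr /=; first by rewrite mulrCA mulrA.
  move=> k; rewrite -subr_eq0 opprK -addrA -natrD addr_eq0.
  exact: zreg.
have -> : a + 1 = a - b%:R + 1 + b%:R by rewrite addrAC subrK.
rewrite step // Gfact invfM [RHS]mulrA mulfK ?Gn0 //; congr (_ / _).
rewrite (reindex_inj rev_ord_inj) /=; apply: eq_bigr => i _.
rewrite natrB // -natr1 opprB addrCA addrC -!addrA [1 + _]addrC.
by congr (_ + _); rewrite addrC -addrA.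
Qed.

End Binomial.

Section QSystem.
Variables (K : numFieldType) (n : nat).

(* The pair (a, k) stands for the index (a, m) with m = k + 1. *)
Definition qidx := ('I_n * nat)%type.
Definition level (i : qidx) : nat := i.2.+1.

Definition imx := qidx -> qidx -> K.
Implicit Types (A B D Dinv G : imx) (nu : qidx -> K) (Q : qidx -> fps K n).

Definition imul_wd A B :=
  forall i j, finite_set [set k | A i k * B k j != 0].
(* Meaningful under [imul_wd A B]: the sums have finite support. *)
Definition imul A B : imx :=
  fun i j => \sum_(k \in [set: qidx]) A i k * B k j.
Definition ione : imx := fun i j => (i == j)%:R.

(* [Dinv] is an argument throughout: an infinite matrix may have several
   inverses, one of which is fixed. *)
Definition iinverse D Dinv :=
  [/\ imul_wd D Dinv, imul_wd Dinv D,
      forall i j, imul D Dinv i j = ione i j &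
      forall i j, imul Dinv D i j = ione i j].

(* Binomial series, i.e. the a-th power with constant term 1 of a series f
   with constant term 1; not meaningful for other f. *)
Definition fps_pow (f : fps K n) (a : K) : fps K n :=
  isum (fun k : nat => fpsC n (cbinom a k) * (f - 1) ^+ k).

Definition Qsolution D G Q :=
  (forall i, Q i 0%MM = 1) /\
  forall i,
    [/\ iprod_cvg (fun j => fps_pow (Q j) (D i j)),
        iprod_cvg (fun j => fps_pow (Q j) (G i j)) &
        iprod (fun j => fps_pow (Q j) (D i j))
        + fpsX K i.1 ^+ level i * iprod (fun j => fps_pow (Q j) (G i j)) = 1].

Definition Qcanonical D Dinv Q :=
  forall i,
    (forall j, iprod_cvg (fun l => fps_pow (Q l) (Dinv i j * D j l))) /\
    iprod_to (fun j => iprod (fun l => fps_pow (Q l) (Dinv i j * D j l))) (Q i).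

Definition nu_admissible Dinv nu :=
  forall j, finite_set [set i | nu i * Dinv i j != 0].

(* For N : Nvec the finite set H(N) of the i with N i != 0 is [finsupp N]. *)
Definition Nvec := {fsfun qidx -> nat with 0%N}.

(* Both sums have finite support: the first one if nu is admissible, the second
   one because N is finitely supported. *)
Definition Pvec Dinv G nu (N : Nvec) (i : qidx) : K :=
  - (\sum_(j \in [set: qidx]) nu j * Dinv j i)
  - (\sum_(j \in [set: qidx]) (N j)%:R * imul G Dinv j i).

Definition Fmx Dinv G nu (N : Nvec) : imx :=
  fun i j => (i == j)%:R * Pvec Dinv G nu N j + imul G Dinv i j * (N j)%:R.

(* det of (F i j) for i, j in S; it does not depend on the order in which the
   elements of S are enumerated. *)
Definition fset_det (S : {fset qidx}) (F : imx) : K :=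
  \det (\matrix_(i < size S, j < size S)
          F (tnth (in_tuple S) i) (tnth (in_tuple S) j)).

Definition Nmonom (N : Nvec) : fps K n :=
  \prod_(i <- finsupp N) fpsX K i.1 ^+ (level i * N i).

Definition Kseries Dinv G nu : fps K n :=
  isum (fun N : Nvec =>
    fpsC n (\prod_(i <- finsupp N)
              cbinom (Pvec Dinv G nu N i + (N i)%:R) (N i))
    * Nmonom N).

Definition Rseries Dinv G nu : fps K n :=
  isum (fun N : Nvec =>
    fpsC n (fset_det (finsupp N) (Fmx Dinv G nu N)
            * \prod_(i <- finsupp N)
                ((N i)%:R^-1
                 * cbinom (Pvec Dinv G nu N i + (N i)%:R - 1) (N i).-1))
    * Nmonom N).

Definition Qnu Q nu : fps K n := iprod (fun i => fps_pow (Q i) (nu i)).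

End QSystem.

(* Main.v *)
Require Import Defs.
From mathcomp Require Import all_boot all_order all_algebra.
From mathcomp Require Import complex reals.
From mathcomp Require Import perm finmap mpoly ring.
From mathcomp Require Import boolp classical_sets functions cardinality fsbigop.
Set Implicit Arguments.
Unset Strict Implicit.
Unset Printing Implicit Defensive.
Import GRing.Theory Num.Theory.
Local Open Scope ring_scope.

(** Put P_i = prod_j Q_j^(D_ij), G' = G D^-1 and x_i = (y_a)^m for i = (a, m).
    The system says P_i = 1 - x_i prod_j Q_j^(G_ij), so P_i is congruent to 1
    modulo degree m, and every product of complex powers of the P_i converges.
    Being canonical means Q_i = prod_j P_j^((D^-1)_ij).  Hence, with
    mu = nu D^-1, the product Q^nu converges to P^mu = prod_j P_j^(mu_j)
    ([iprod_to_canonical]), and the system becomes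
    P_i = 1 - x_i P^(G'_i), where G'_i is the i-th row of G'.  Only D^-1 and G'
    are left.

    Multiplying this equation by P^mu gives the linear recurrence
      f(mu) = f(mu + e_i) + x_i f(mu + G'_i)        for all i and mu        (1)
    for f(mu) = P^mu.  Call a family f of power series recursive if it satisfies
    (1), if its coefficients are polynomial in each mu_i, and if each coefficient
    depends on finitely many mu_i only.  A recursive family is determined by its
    value at mu = 0 ([recursive_family_unique]): if f(0) = 0, induction on the
    degree kills the second term of (1), so that the next coefficients of f are
    invariant under mu_i -> mu_i + 1, hence constant in mu_i because a periodic
    polynomial is constant; all mu_i that matter may then be set to 0.  As (1) is
    linear over power series, f(mu) = P^mu f(0) for every recursive f.

    It remains to see that K and R are recursive and that R at mu = 0 is 1.  Both
    are sums over N of x^N times a determinant whose j-th column depends on mu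
    and N only through N_j and P_j = - mu_j - (N G')_j.  Since P_j is the same
    for (mu, N + e_i) and for (mu + G'_i, N), and replacing mu by mu + e_i only
    changes P_i to P_i - 1, recurrence (1) is Pascal's rule in the i-th column
    ([detcoef_recursive]).  When mu = 0, the vector N is a left null vector of
    the matrix F, so all terms of R but the one with N = 0 vanish.  This replaces
    the multivariate Lagrange inversion formula of Good, in whose two forms K
    and R are the coefficient sums. *)

(** * Polynomial functions *)

Section PolyFun.
Variable K : numFieldType.
Implicit Types h : K -> K.

Definition polyfun h := exists p : {poly K}, forall t, h t = p.[t].

Lemma polyfunC c : polyfun (fun=> c).
Proof. by exists c%:P => t; rewrite hornerC. Qed.

Lemma polyfun_id : polyfun id.
Proof. by exists 'X => t; rewrite hornerX. Qed.

Lemma polyfunD h1 h2 : polyfun h1 -> polyfun h2 -> polyfun (fun t => h1 t + h2 t).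
Proof. by move=> [p ph] [q qh]; exists (p + q) => t; rewrite hornerD ph qh. Qed.

Lemma polyfunM h1 h2 : polyfun h1 -> polyfun h2 -> polyfun (fun t => h1 t * h2 t).
Proof. by move=> [p ph] [q qh]; exists (p * q) => t; rewrite hornerM ph qh. Qed.

Lemma polyfunB h1 h2 : polyfun h1 -> polyfun h2 -> polyfun (fun t => h1 t - h2 t).
Proof. by move=> [p ph] [q qh]; exists (p - q) => t; rewrite !hornerE ph qh. Qed.

Lemma polyfun_sum (I : Type) (r : seq I) (P : pred I) (F : I -> K -> K) :
  (forall i, polyfun (F i)) -> polyfun (fun t => \sum_(i <- r | P i) F i t).
Proof.
move=> FP; elim: r => [|i r [p ph]].
  by exists 0 => t; rewrite big_nil horner0.
have [q qh] := FP i; exists (if P i then q + p else p) => t.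
by rewrite big_cons; case: (P i); rewrite ?hornerD ph ?qh.
Qed.

Lemma polyfun_prod (I : Type) (r : seq I) (P : pred I) (F : I -> K -> K) :
  (forall i, polyfun (F i)) -> polyfun (fun t => \prod_(i <- r | P i) F i t).
Proof.
move=> FP; elim: r => [|i r [p ph]].
  by exists 1 => t; rewrite big_nil hornerE.
have [q qh] := FP i; exists (if P i then q * p else p) => t.
by rewrite big_cons; case: (P i); rewrite ?hornerM ph ?qh.
Qed.

Lemma polyfun_comp h1 h2 : polyfun h1 -> polyfun h2 -> polyfun (h1 \o h2).
Proof.
by move=> [p ph] [q qh]; exists (p \Po q) => t; rewrite /= horner_comp ph qh.
Qed.

Lemma eq_polyfun h1 h2 : h1 =1 h2 -> polyfun h1 -> polyfun h2.
Proof. by move=> eh [p ph]; exists p => t; rewrite -eh. Qed.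

Lemma polyfun_det m (A : K -> 'M[K]_m) :
  (forall i j, polyfun (fun t => A t i j)) -> polyfun (fun t => \det (A t)).
Proof.
move=> AP; apply: polyfun_sum => s; apply: polyfunM; first exact: polyfunC.
by apply: polyfun_prod.
Qed.

(** Extends identities from natural to arbitrary exponents: in characteristic 0
    two different polynomials cannot agree at all natural numbers. *)
Lemma polyfun_nat_eq h1 h2 : polyfun h1 -> polyfun h2 ->
  (forall k : nat, h1 k%:R = h2 k%:R) -> h1 =1 h2.
Proof.
move=> [p ph] [q qh] e t; rewrite ph qh; congr (_.[t]).
apply/eqP; rewrite -subr_eq0; apply/negPn/negP => nz.
pose rs := [seq k%:R | k <- iota 0 (size (p - q))] : seq K.
suff: (size rs < size (p - q)%R)%N by rewrite size_map size_iota ltnn.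
apply: max_poly_roots nz _ _.
  by apply/allP => _ /mapP [k _ ->]; rewrite /root !hornerE -ph -qh e subrr.
by rewrite map_inj_uniq ?iota_uniq // => i j /eqP; rewrite eqr_nat => /eqP.
Qed.

Lemma polyfun_periodic h : polyfun h -> (forall t, h t = h (t + 1)) ->
  forall t, h t = h 0.
Proof.
move=> hP per; apply: (polyfun_nat_eq hP (polyfunC _)).
by elim=> // k IH; rewrite -natr1 -per.
Qed.

Lemma polyfun_cbinom k : polyfun (fun t : K => cbinom t k).
Proof.
apply: polyfunM; last exact: polyfunC.
by apply: polyfun_prod => i; apply: polyfunB; [exact: polyfun_id|exact: polyfunC].
Qed.

Lemma cbinom0 (t : K) : cbinom t 0 = 1.
Proof. by rewrite /cbinom big_ord0 fact0 divr1. Qed.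

Lemma cbinomS (t : K) k : cbinom (t + 1) k.+1 = cbinom t k.+1 + cbinom t k.
Proof.
rewrite /cbinom [in LHS]big_ord_recl [in RHS]big_ord_recr /=.
have -> : \prod_(i < k) (t + 1 - (bump 0 i)%:R) = \prod_(i < k) (t - i%:R).
  by apply: eq_bigr => i _; rewrite /bump /= natrD; ring.
rewrite factS natrM; set P := \prod_(_ < _) _.
have k1 : (k.+1%:R : K) != 0 by rewrite pnatr_eq0.
have kf : ((k`!)%:R : K) != 0 by rewrite pnatr_eq0 -lt0n fact_gt0.
by rewrite -natr1 in k1 *; field; rewrite k1 kf.
Qed.

Lemma cbinom_nat n k : cbinom (n%:R : K) k = ('C(n, k))%:R.
Proof.
elim: n k => [|n IH] [|k]; rewrite ?bin0 ?cbinom0 //.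
  by rewrite /cbinom big_ord_recl subrr !mul0r.
by rewrite -natr1 cbinomS !IH binS natrD.
Qed.

End PolyFun.

(** * Congruences between formal power series *)

Section Eqmod.
Variables (K : comNzRingType) (n : nat).
Local Notation fps := (fps K n).
Implicit Types (f g h : fps) (m u : 'X_{1..n}).

Lemma coef_fpsD f g m : (f + g) m = f m + g m. Proof. by []. Qed.
Lemma coef_fpsB f g m : (f - g) m = f m - g m. Proof. by []. Qed.
Lemma coef_fps1 m : (1 : fps) m = (m == 0%MM)%:R.
Proof. by rewrite /GRing.one /=; case: eqP. Qed.

Lemma coef_fps_sum (I : Type) (r : seq I) (P : pred I) (F : I -> fps) m :
  (\sum_(i <- r | P i) F i) m = \sum_(i <- r | P i) F i m.
Proof. by elim/big_rec2: _ => // i x y _ <-. Qed.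

Lemma fps_eqmod_refl d f : fps_eqmod d f f.
Proof. by []. Qed.

Lemma fps_eqmod_sym d f g : fps_eqmod d f g -> fps_eqmod d g f.
Proof. by move=> fg m md; rewrite fg. Qed.

Lemma fps_eqmod_trans d g f h :
  fps_eqmod d f g -> fps_eqmod d g h -> fps_eqmod d f h.
Proof. by move=> fg gh m md; rewrite fg // gh. Qed.

Lemma fps_eqmod_le d e f g : (d <= e)%N -> fps_eqmod e f g -> fps_eqmod d f g.
Proof. by move=> de fg m md; apply: fg; apply: leq_trans de. Qed.

Lemma fps_eqmodB d f f' g g' :
  fps_eqmod d f f' -> fps_eqmod d g g' -> fps_eqmod d (f - g) (f' - g').
Proof. by move=> ff gg m md; rewrite !coef_fpsB ff ?gg. Qed.

Lemma fps_eqmodM d f f' g g' :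
  fps_eqmod d f f' -> fps_eqmod d g g' -> fps_eqmod d (f * g) (f' * g').
Proof.
move=> ff gg m md; apply: eq_bigr => -[[k1 ?] [k2 ?]] /= /eqP mE.
by rewrite ff ?gg //; apply: leq_ltn_trans md; rewrite mE mdegD ?leq_addr ?leq_addl.
Qed.

Lemma fps_eqmod_prod d (I : choiceType) (r : seq I) (F G : I -> fps) :
  {in r, forall i, fps_eqmod d (F i) (G i)} ->
  fps_eqmod d (\prod_(i <- r) F i) (\prod_(i <- r) G i).
Proof.
elim: r => [|i r IH] FG; first by rewrite !big_nil.
rewrite !big_cons; apply: fps_eqmodM; first by apply: FG; rewrite inE eqxx.
by apply: IH => j jr; apply: FG; rewrite inE jr orbT.
Qed.

Lemma fps_eqmodX d f g k : fps_eqmod d f g -> fps_eqmod d (f ^+ k) (g ^+ k).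
Proof.
by move=> fg; elim: k => // k IH; rewrite !exprS; apply: fps_eqmodM.
Qed.

Lemma fps_eqmod0M d e f g :
  fps_eqmod d f 0 -> fps_eqmod e g 0 -> fps_eqmod (d + e) (f * g) 0.
Proof.
move=> f0 g0 m md.
rewrite [LHS]big1 // => -[[k1 ?] [k2 ?]] /= /eqP mE.
case: (ltnP (mdeg k1) d) => [lt|le1]; first by rewrite f0 // mul0r.
case: (ltnP (mdeg k2) e) => [lt|le2]; first by rewrite g0 // mulr0.
by move: md; rewrite mE mdegD ltnNge leq_add.
Qed.

Lemma fps_eqmod0X f k : fps_eqmod 1 f 0 -> fps_eqmod k (f ^+ k) 0.
Proof.
move=> f0; elim: k => [//|k IH]; rewrite exprS -add1n.
exact: fps_eqmod0M.
Qed.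

Lemma fps_eqmod1 f g : f 0%MM = g 0%MM -> fps_eqmod 1 f g.
Proof. by move=> e m; rewrite ltnS leqn0 mdeg_eq0 => /eqP ->. Qed.

Definition fpsM u : fps := FPS (fun m => (m == u)%:R).

Lemma coef_fpsM u f m :
  (fpsM u * f) m = if (u <= m)%MM then f (m - u)%MM else 0.
Proof.
have lem k k' : m == (k + k')%MM -> (mdeg k < (mdeg m).+1)%N.
  by move/eqP=> ->; rewrite mdegD ltnS leq_addr.
case: ifP => [um|umN].
  have mE : m == (u + (m - u))%MM by rewrite addmC submK.
  have mE' := mE; rewrite addmC in mE'.
  rewrite [LHS](bigD1 (BMultinom (lem _ _ mE), BMultinom (lem _ _ mE'))) //=.
  rewrite eqxx mul1r big1 ?addr0 // => -[[k1 lt1] [k2 lt2]] /= /andP [/eqP mk].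
  case: (eqVneq k1 u) => [k1u|_]; last by rewrite mul0r.
  case/negP; apply/eqP; congr (_, _); apply: val_inj => //=.
  by rewrite mk k1u addmC addmK.
rewrite [LHS]big1 // => -[[k1 lt1] [k2 lt2]] /= /eqP mk.
case: eqP => [k1u|]; last by rewrite mul0r.
by rewrite mk k1u lem_addr in umN.
Qed.

Lemma fpsMD u v : fpsM (u + v) = fpsM u * fpsM v.
Proof.
apply/fpsP => m; rewrite coef_fpsM /=; case: ifP => [um|umN].
  congr (_%:R); congr (nat_of_bool _); apply/eqP/eqP => [->|<-].
    by rewrite addmC addmK.
  by rewrite addmC submK.
by case: eqP => // me; rewrite me lem_addr in umN.
Qed.

Lemma fpsM0 : fpsM 0 = 1.
Proof. by apply/fpsP => m; rewrite coef_fps1. Qed.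

Lemma fpsXE a k : fpsX K a ^+ k = fpsM (U_(a) *+ k).
Proof.
elim: k => [|k IH]; first by rewrite expr0 mulm0n fpsM0.
by rewrite exprS IH mulmS fpsMD.
Qed.

Lemma fpsM_eqmod0 u : fps_eqmod (mdeg u) (fpsM u) 0.
Proof. by move=> m /=; case: eqP => // ->; rewrite ltnn. Qed.

Lemma coef_fpsC c f m : (fpsC n c * f) m = c * f m.
Proof.
have lem : (mdeg (0%MM : 'X_{1..n}) < (mdeg m).+1)%N by rewrite mdeg0.
rewrite [LHS](bigD1 (BMultinom lem, BMultinom (ltnSn (mdeg m)))) /=; last first.
  by rewrite add0m.
rewrite eqxx big1 ?addr0 // => -[[k1 lt1] [k2 lt2]] /= /andP [/eqP mk].
case: (eqVneq k1 0%MM) => [k10|_]; last by rewrite mul0r.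
case/negP; apply/eqP; congr (_, _); apply: val_inj => //=.
by rewrite mk k10 add0m.
Qed.

Lemma coef0_fpsM f g : (f * g) 0%MM = f 0%MM * g 0%MM.
Proof.
have d1 : (mdeg (0%MM : 'X_{1..n}) < 1)%N by rewrite mdeg0.
have fC : fps_eqmod 1 f (fpsC n (f 0%MM)) by apply: fps_eqmod1; rewrite /= eqxx.
by rewrite (fps_eqmodM fC (fps_eqmod_refl (d := 1) g)) // coef_fpsC.
Qed.

End Eqmod.

(** * Complex powers of power series with constant term 1 *)

Section FpsPow.
Variables (K : numFieldType) (n : nat).
Local Notation fps := (fps K n).
Implicit Types (f g h : fps) (m : 'X_{1..n}) (a b : K).

(** As [f - 1] has no constant term, its k-th power only contributes in degrees
    at least k, so the binomial series may be cut off above the degree. *)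
Lemma coef_fps_pow f a m d : f 0%MM = 1 -> (mdeg m < d)%N ->
  fps_pow f a m = \sum_(k < d) cbinom a k * ((f - 1) ^+ k) m.
Proof.
move=> f1 md; have -> : fps_pow f a m =
    \sum_(k \in [set: nat]%classic) cbinom a k * ((f - 1) ^+ k) m.
  by apply: eq_fsbigr => k _; apply: coef_fpsC.
rewrite -(big_mkord xpredT (fun k => cbinom a k * ((f - 1) ^+ k) m)).
rewrite (fsbigE (index_iota 0 d)) ?iota_uniq //.
  by apply: eq_bigl => k; rewrite in_setT.
move=> k _; rewrite mem_index_iota -leqNgt => dk.
rewrite (@fps_eqmod0X _ _ (f - 1) k _ m) ?mulr0 //; last exact: leq_trans dk.
by apply: fps_eqmod1; rewrite coef_fpsB f1 coef_fps1 eqxx subrr.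
Qed.

(** Each coefficient of [fps_pow f t] is a polynomial in t.  All laws of complex
    powers follow from this: both sides are polynomial in the exponents and they
    agree at natural exponents, where [fps_pow] is the ordinary power. *)
Definition fps_polyfun (F : K -> fps) := forall m, polyfun (fun t => F t m).

Lemma fps_polyfunC f : fps_polyfun (fun=> f).
Proof. by move=> m; apply: polyfunC. Qed.

Lemma fps_polyfunB F G :
  fps_polyfun F -> fps_polyfun G -> fps_polyfun (fun t => F t - G t).
Proof. by move=> FP GP m; apply: polyfunB. Qed.

Lemma fps_polyfunM F G :
  fps_polyfun F -> fps_polyfun G -> fps_polyfun (fun t => F t * G t).
Proof. by move=> FP GP m; apply: polyfun_sum => k; apply: polyfunM. Qed.

Lemma fps_polyfun_prod (I : Type) (r : seq I) (F : I -> K -> fps) :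
  (forall i, fps_polyfun (F i)) -> fps_polyfun (fun t => \prod_(i <- r) F i t).
Proof.
move=> FP; elim: r => [|i r IH] m.
  by apply: (eq_polyfun _ (polyfunC ((1 : fps) m))) => t; rewrite big_nil.
apply: (eq_polyfun _ (fps_polyfunM (FP i) IH m)) => t /=.
by rewrite big_cons.
Qed.

Lemma fps_polyfun_nat_eq F G : fps_polyfun F -> fps_polyfun G ->
  (forall k : nat, F k%:R = G k%:R) -> F =1 G.
Proof.
move=> FP GP e t; apply/fpsP => m.
by apply: (polyfun_nat_eq (FP m) (GP m)) => k; rewrite e.
Qed.

Lemma fps_polyfun_pow f : f 0%MM = 1 -> fps_polyfun (fps_pow f).
Proof.
move=> f1 m.
apply: (eq_polyfun (fun t => esym (coef_fps_pow t f1 (ltnSn (mdeg m))))).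
apply: polyfun_sum => k; apply: polyfunM; last exact: polyfunC.
exact: polyfun_cbinom.
Qed.

Lemma fps_polyfun_comp F (h : K -> K) :
  fps_polyfun F -> polyfun h -> fps_polyfun (F \o h).
Proof. by move=> FP hP m; apply: (polyfun_comp (FP m) hP). Qed.

Lemma fps_pow_nat f k : f 0%MM = 1 -> fps_pow f k%:R = f ^+ k.
Proof.
move=> f1; apply/fpsP => m.
rewrite (@coef_fps_pow _ _ m (k.+1 + (mdeg m).+1)) // ?leq_addl //.
rewrite big_split_ord /= [X in _ + X]big1 ?addr0 => [|i _]; last first.
  by rewrite cbinom_nat bin_small ?mul0r // ltn_addr.
rewrite -{2}[f](subrK 1) exprD1n coef_fps_sum; apply: eq_bigr => i _.
rewrite cbinom_nat mulr_natl; elim: 'C(k, i) => // c IH.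
by rewrite !mulrS IH.
Qed.

Lemma fps_pow0 f : f 0%MM = 1 -> fps_pow f 0 = 1.
Proof. by move=> f1; rewrite -[0]/(0%:R) fps_pow_nat. Qed.

Lemma fps_pow1 f : f 0%MM = 1 -> fps_pow f 1 = f.
Proof. by move=> f1; rewrite -[1]/(1%:R) fps_pow_nat. Qed.

Lemma fps_powD f a b : f 0%MM = 1 ->
  fps_pow f (a + b) = fps_pow f a * fps_pow f b.
Proof.
move=> f1; have P := fps_polyfun_pow f1.
have addP c : polyfun (fun t => t + c) := polyfunD (@polyfun_id K) (polyfunC c).
apply: (@fps_polyfun_nat_eq (fun a => fps_pow f (a + b))
         (fun a => fps_pow f a * fps_pow f b)) => [||k].
- exact: fps_polyfun_comp P (addP b).
- exact: fps_polyfunM P (fps_polyfunC _).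
rewrite addrC; apply: (@fps_polyfun_nat_eq (fun b => fps_pow f (b + k%:R))
         (fun b => fps_pow f k%:R * fps_pow f b)) => [||l].
- exact: fps_polyfun_comp P (addP _).
- exact: fps_polyfunM (fps_polyfunC _) P.
by rewrite -natrD !fps_pow_nat // -exprD addnC.
Qed.

Lemma fps_pow_eqmod d f g a : f 0%MM = 1 -> g 0%MM = 1 ->
  fps_eqmod d f g -> fps_eqmod d (fps_pow f a) (fps_pow g a).
Proof.
move=> f1 g1 fg m md; rewrite (coef_fps_pow a f1 md) (coef_fps_pow a g1 md).
apply: eq_bigr => k _; congr (_ * _).
by apply: (@fps_eqmodX _ _ d); first apply: fps_eqmodB.
Qed.

Lemma fps_pow_of_1 a : fps_pow (1 : fps) a = 1.
Proof.
have e1 : (1 : fps) 0%MM = 1 by rewrite coef_fps1 eqxx.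
apply: (@fps_polyfun_nat_eq (fps_pow 1) (fun=> 1)) => [||k].
- exact: fps_polyfun_pow.
- exact: fps_polyfunC.
by rewrite fps_pow_nat // expr1n.
Qed.

Lemma coef0_fps_pow f a : f 0%MM = 1 -> fps_pow f a 0%MM = 1.
Proof.
move=> f1; have e1 : (1 : fps) 0%MM = 1 by rewrite coef_fps1 eqxx.
rewrite (@fps_pow_eqmod 1 f 1 a f1 e1) ?fps_pow_of_1 ?mdeg0 //.
by apply: fps_eqmod1; rewrite f1.
Qed.

Lemma coef0_fps_prod (I : Type) (r : seq I) (F : I -> fps) :
  (forall i, F i 0%MM = 1) -> (\prod_(i <- r) F i) 0%MM = 1.
Proof.
move=> F1; elim/big_rec: _ => [|i x _ x1]; first by rewrite coef_fps1 eqxx.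
by rewrite coef0_fpsM F1 x1 mulr1.
Qed.

Lemma fps_powM f g a : f 0%MM = 1 -> g 0%MM = 1 ->
  fps_pow (f * g) a = fps_pow f a * fps_pow g a.
Proof.
move=> f1 g1; have fg1 : (f * g) 0%MM = 1 by rewrite coef0_fpsM f1 g1 mulr1.
apply: (@fps_polyfun_nat_eq (fps_pow (f * g))
         (fun t => fps_pow f t * fps_pow g t)) => [||k].
- exact: fps_polyfun_pow.
- by apply: fps_polyfunM; apply: fps_polyfun_pow.
by rewrite !fps_pow_nat // exprMn.
Qed.

Lemma fps_pow_pow f a b : f 0%MM = 1 ->
  fps_pow (fps_pow f a) b = fps_pow f (a * b).
Proof.
move=> f1; have fa1 := coef0_fps_pow a f1.
apply: (@fps_polyfun_nat_eq (fps_pow (fps_pow f a))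
         (fun t => fps_pow f (a * t))) => [||k].
- exact: fps_polyfun_pow.
- apply: fps_polyfun_comp (fps_polyfun_pow f1) _.
  exact: polyfunM (polyfunC a) (@polyfun_id K).
rewrite fps_pow_nat //; elim: k => [|k IH]; first by rewrite mulr0 fps_pow0.
by rewrite exprS IH -fps_powD // mulrSr [in RHS]addrC mulrDr mulr1.
Qed.

Lemma fps_pow_prod (I : Type) (r : seq I) (F : I -> fps) a :
  (forall i, F i 0%MM = 1) ->
  fps_pow (\prod_(i <- r) F i) a = \prod_(i <- r) fps_pow (F i) a.
Proof.
move=> F1; elim: r => [|i r IH]; first by rewrite !big_nil fps_pow_of_1.
by rewrite !big_cons fps_powM ?IH ?coef0_fps_prod.
Qed.

Lemma fps_pow_sum (I : Type) (r : seq I) f (c : I -> K) : f 0%MM = 1 ->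
  fps_pow f (\sum_(i <- r) c i) = \prod_(i <- r) fps_pow f (c i).
Proof.
move=> f1; elim: r => [|i r IH]; first by rewrite !big_nil fps_pow0.
by rewrite !big_cons fps_powD ?IH.
Qed.

Lemma fps_unit1 f : f 0%MM = 1 -> f \is a GRing.unit.
Proof.
move=> f1; apply/unitrPr; exists (fps_pow f (-1)).
by rewrite -{1}(fps_pow1 f1) -fps_powD // subrr fps_pow0.
Qed.

(** * Infinite products *)

Lemma iprod_coef0 (I : choiceType) (F : I -> fps) P :
  (forall i, F i 0%MM = 1) -> iprod_to F P -> P 0%MM = 1.
Proof.
move=> F1 /(_ 1%N) [S SP].
by rewrite -(SP S) ?fsubset_refl ?mdeg0 // coef0_fps_prod.
Qed.

Lemma iprod_to_pow (I : choiceType) (F : I -> fps) P a :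
  (forall i, F i 0%MM = 1) -> iprod_to F P ->
  iprod_to (fun i => fps_pow (F i) a) (fps_pow P a).
Proof.
move=> F1 FP d; have P1 := iprod_coef0 F1 FP; have [S SP] := FP d.
exists S => T ST; rewrite -(fps_pow_prod T a F1).
by apply: fps_pow_eqmod (SP _ ST) => //; apply: coef0_fps_prod.
Qed.

Lemma iprod_cvgP (I : choiceType) (F : I -> fps) :
  iprod_cvg F -> iprod_to F (iprod F).
Proof. by move=> [P FP]; rewrite (iprodE FP). Qed.

(** Modulo degree [d] such a product is the finite product over [S d], whatever
    finite superset of [S d] is used; hence these partial products determine a
    series coefficient by coefficient. *)
Lemma iprod_to_locally_finite (I : choiceType) (F : I -> fps)
    (S : nat -> {fset I}) :
    (forall d i, i \notin S d -> fps_eqmod d (F i) 1) ->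
  iprod_cvg F /\ forall d, fps_eqmod d (iprod F) (\prod_(i <- S d) F i).
Proof.
move=> FS.
have ext d (T : {fset I}) : (S d `<=` T)%fset ->
    fps_eqmod d (\prod_(i <- T) F i) (\prod_(i <- S d) F i).
  move=> ST; rewrite (big_fsetID _ (fun i => i \in S d) T) /=.
  have -> : [fset i | i in T & i \in S d]%fset = S d.
    apply/fsetP => i; rewrite !inE andbC.
    by case: (boolP (i \in S d)) => // /(fsubsetP ST) ->.
  rewrite -[X in fps_eqmod d _ X]mulr1; apply: fps_eqmodM => //.
  apply: (@fps_eqmod_trans _ _ _
      (\prod_(i <- [fset i | i in T & i \notin S d]%fset) 1)).
    by apply: fps_eqmod_prod => i; rewrite !inE => /andP [_]; apply: FS.
  by rewrite big1.
(* The coefficients of degree d are already those of the product over S (d+1). *)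
pose P : fps := FPS (fun m => (\prod_(i <- S (mdeg m).+1) F i) m).
have PS d : fps_eqmod d P (\prod_(i <- S d) F i).
  move=> m md /=; rewrite -(ext (mdeg m).+1 (S d `|` S (mdeg m).+1)%fset) //.
    by rewrite -(ext d (S d `|` S (mdeg m).+1)%fset) // fsubsetUl.
  exact: fsubsetUr.
have FP : iprod_to F P.
  by move=> d; exists (S d) => T /ext/fps_eqmod_trans; apply; apply: fps_eqmod_sym.
by split; [exists P | rewrite (iprodE FP)].
Qed.

End FpsPow.

(** * Families of power series with the recurrence of the powers of a solution *)

Section Recurrence.
Variables (K : numFieldType) (n : nat).
Local Notation fps := (fps K n).
Local Notation qidx := (qidx n).
Implicit Types (mu : qidx -> K) (G : qidx -> qidx -> K) (F : (qidx -> K) -> fps).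

Definition xvar (i : qidx) : fps := fpsX K i.1 ^+ level i.

Definition shift mu (i : qidx) (t : K) : qidx -> K :=
  fun j => mu j + (if j == i then t else 0).

Lemma xvar_eqmod0 i : fps_eqmod (level i) (xvar i) 0.
Proof.
rewrite /xvar fpsXE; apply: fps_eqmod_le (@fpsM_eqmod0 _ _ _).
by rewrite mdegMn mdeg1 mul1n.
Qed.

(** The recurrence is what [mu |-> prod_i P_i^(mu_i)] inherits from
    [P_i = 1 - x_i prod_j P_j^(G_ij)].  The other two conditions make the
    recurrence determine the family from its value at 0. *)
Definition recursive_family G F :=
  [/\ forall mu i, F mu = F (shift mu i 1) + xvar i * F (fun j => mu j + G i j),
      forall mu i, fps_polyfun (fun t => F (shift mu i t)) &
      forall d, exists S : {fset qidx}, forall mu mu',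
        {in S, mu =1 mu'} -> fps_eqmod d (F mu) (F mu')].

Lemma recursive_familyM G F f :
  recursive_family G F -> recursive_family G (fun mu => F mu * f).
Proof.
case=> rec pol loc; split.
- by move=> mu i; rewrite {1}(rec mu i) mulrDl mulrA.
- by move=> mu i; apply: fps_polyfunM (pol mu i) (fps_polyfunC _).
by move=> d; have [S SP] := loc d; exists S => mu mu' /SP e; apply: fps_eqmodM.
Qed.

Lemma recursive_familyB G F F' : recursive_family G F -> recursive_family G F' ->
  recursive_family G (fun mu => F mu - F' mu).
Proof.
case=> rec pol loc [rec' pol' loc']; split.
- by move=> mu i; rewrite {1}(rec mu i) {1}(rec' mu i) mulrBr; ring.
- by move=> mu i; apply: fps_polyfunB.
move=> d; have [S SP] := loc d; have [S' SP'] := loc' d.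
exists (S `|` S')%fset => mu mu' e.
by apply: fps_eqmodB; [apply: SP | apply: SP'] => i iS; apply: e;
  rewrite inE iS ?orbT.
Qed.

(** By induction on the degree, the term with [xvar i] vanishes modulo degree
    [d + 1], because [xvar i] has positive degree.  What is left of the recurrence
    is 1-periodicity in each [mu_i], and a periodic polynomial is constant. *)
Lemma recursive_family_eq0 G F mu :
  recursive_family G F -> F (fun=> 0) = 0 -> F mu = 0.
Proof.
case=> rec pol loc F0.
suff FE d mu' : fps_eqmod d (F mu') 0.
  by apply/fpsP => m; rewrite (FE (mdeg m).+1).
elim: d mu' => [//|d IH] mu'.
have per nu i : fps_eqmod d.+1 (F nu) (F (shift nu i 1)).
  move=> m md; rewrite (rec nu i) coef_fpsD.
  have -> : (xvar i * F (fun j => nu j + G i j)) m = 0.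
    apply: (fps_eqmod0M (@xvar_eqmod0 i) (IH _)).
    by apply: leq_trans md _; rewrite /level addSn ltnS leq_addl.
  by rewrite addr0.
have const nu i t : fps_eqmod d.+1 (F nu) (F (shift nu i t)).
  move=> m md; have h0 : shift nu i 0 = nu.
    by apply/funext => j; rewrite /shift if_same addr0.
  rewrite -{1}h0 (polyfun_periodic (pol nu i m) _ t) // => s.
  rewrite (per _ i) //; congr (F _ m); apply/funext => j.
  by rewrite /shift; case: ifP => _; rewrite ?addr0 // addrA.
(* Clear the entries of the vector one at a time. *)
have clear_seq (s : seq qidx) :
    fps_eqmod d.+1 (F mu') (F (fun j => if j \in s then 0 else mu' j)).
  elim: s => [//|i s IHs]; apply: fps_eqmod_trans IHs _.
  set nu := (X in F X); apply: fps_eqmod_trans (const nu i (- nu i)) _.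
  suff -> : shift nu i (- nu i) = (fun j => if j \in i :: s then 0 else mu' j).
    exact: fps_eqmod_refl.
  apply/funext => j; rewrite /shift in_cons.
  by case: eqVneq => [->|_]; rewrite ?subrr ?addr0.
have [S SP] := loc d.+1; rewrite -[X in fps_eqmod _ _ X]F0.
apply: fps_eqmod_trans (clear_seq S) _; apply: SP => i iS.
by rewrite iS.
Qed.

(** Multiplying by a fixed series preserves recursive families, so the two sides
    are recursive families that agree at 0. *)
Lemma recursive_family_unique G F E mu :
    recursive_family G F -> recursive_family G E -> E (fun=> 0) = 1 ->
  F mu = E mu * F (fun=> 0).
Proof.
move=> FP EP E0; apply/eqP; rewrite -subr_eq0; apply/eqP.
apply: (recursive_family_eq0 mu
          (recursive_familyB FP (recursive_familyM (F (fun=> 0)) EP))).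
by rewrite E0 mul1r subrr.
Qed.

(** * Products of powers of a solution *)

(** These are the i of level at most [d].  They include all i for which [P_i] can
    differ from 1 below degree [d], and all i occurring in the exponents N of
    monomials of degree at most [d]. *)
Definition lowlevel d : {fset qidx} :=
  [fset i in [seq (a, k) | a <- enum 'I_n, k <- iota 0 d]]%fset.

Lemma in_lowlevel d i : (i \in lowlevel d) = (i.2 < d)%N.
Proof.
rewrite inE; case: i => a k; apply/allpairsP/idP => [[[b l]] /= [_ ld [_ ->]]|kd].
  by move: ld; rewrite mem_iota.
by exists (a, k); rewrite mem_enum mem_iota.
Qed.

Variable P : qidx -> fps.
Hypothesis P1 : forall i, fps_eqmod (level i) (P i) 1.

Definition powprod mu : fps := iprod (fun i => fps_pow (P i) (mu i)).

Lemma coef0_factor i : P i 0%MM = 1.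
Proof. by rewrite P1 ?mdeg0 // coef_fps1 eqxx. Qed.

Lemma powprod_cvg_eqmod mu :
  iprod_cvg (fun i => fps_pow (P i) (mu i)) /\
  forall d, fps_eqmod d (powprod mu) (\prod_(i <- lowlevel d) fps_pow (P i) (mu i)).
Proof.
apply: iprod_to_locally_finite => d i; rewrite in_lowlevel -leqNgt => di.
rewrite -[X in fps_eqmod d _ X](fps_pow_of_1 n (mu i)).
apply: fps_pow_eqmod; first exact: coef0_factor.
  by rewrite coef_fps1 eqxx.
by apply: (fps_eqmod_le _ (@P1 i)); apply: leq_trans di _.
Qed.

Lemma powprod_eqmod d mu :
  fps_eqmod d (powprod mu) (\prod_(i <- lowlevel d) fps_pow (P i) (mu i)).
Proof. exact: (powprod_cvg_eqmod mu).2. Qed.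

Lemma fps_eqmodP f g : (forall d, fps_eqmod d f g) -> f = g :> fps.
Proof. by move=> fg; apply/fpsP => m; apply: (fg (mdeg m).+1). Qed.

Lemma coef0_powprod mu : powprod mu 0%MM = 1.
Proof.
rewrite (@powprod_eqmod 1) ?mdeg0 // coef0_fps_prod // => i.
exact: coef0_fps_pow (coef0_factor i).
Qed.

Lemma powprodD mu nu :
  powprod (fun i => mu i + nu i) = powprod mu * powprod nu.
Proof.
apply: fps_eqmodP => d; apply: fps_eqmod_trans (powprod_eqmod _) _.
apply: fps_eqmod_sym.
apply: fps_eqmod_trans (fps_eqmodM (@powprod_eqmod _ mu) (@powprod_eqmod _ nu)) _.
rewrite -big_split /=; apply: fps_eqmod_prod => i _.
by rewrite fps_powD ?coef0_factor.
Qed.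

Lemma powprod0 : powprod (fun=> 0) = 1.
Proof.
apply: fps_eqmodP => d; apply: fps_eqmod_trans (powprod_eqmod _) _.
by rewrite big1 // => i _; rewrite fps_pow0 ?coef0_factor.
Qed.

Lemma powprod_delta i : powprod (fun j => if j == i then 1 else 0) = P i.
Proof.
apply: iprodE => d; exists [fset i]%fset => T; rewrite fsub1set => iT.
rewrite (big_fsetD1 i) //= eqxx fps_pow1 ?coef0_factor // big1_seq ?mulr1 //.
move=> j; rewrite !inE => /andP [_ /andP [/negPf -> _]].
by rewrite fps_pow0 ?coef0_factor.
Qed.

Lemma powprod_recursive G :
    (forall i, P i = 1 - xvar i * powprod (G i)) ->
  recursive_family G powprod.
Proof.
move=> PE; split.
- move=> mu i; rewrite /shift (powprodD mu (fun j => if j == i then 1 else 0)).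
  by rewrite powprod_delta powprodD [P i]PE; ring.
- move=> mu i m.
  apply: (eq_polyfun (fun t => esym (powprod_eqmod (shift mu i t) (ltnSn (mdeg m))))).
  apply: (@fps_polyfun_prod _ _ _ _ (fun j t => fps_pow (P j) (shift mu i t j))) => j.
  apply: (fps_polyfun_comp (fps_polyfun_pow (coef0_factor j))).
  apply: polyfunD; first exact: polyfunC.
  by case: (j == i); [exact: polyfun_id | exact: polyfunC].
move=> d; exists (lowlevel d) => mu mu' e.
apply: fps_eqmod_trans (powprod_eqmod _) _; apply: fps_eqmod_sym.
apply: fps_eqmod_trans (powprod_eqmod _) _.
by apply: fps_eqmod_prod => i /e ->.
Qed.

(** Modulo degree [d] only the columns j in [lowlevel d] matter, and for each of
    them finitely many [mu_i A_ij] are non-zero; a finite set of rows containing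
    these therefore already gives the full exponent of every [P_j] involved. *)
Lemma iprod_to_powprod (A : qidx -> qidx -> K) mu :
    (forall j, finite_set [set i | mu i * A i j != 0]%classic) ->
  iprod_to (fun i => fps_pow (powprod (A i)) (mu i))
    (powprod (fun j => \sum_(i \in [set: qidx]%classic) mu i * A i j)).
Proof.
move=> fin d.
pose S := (\bigcup_(j <- lowlevel d) fset_set [set i | mu i * A i j != 0]%classic)%fset.
exists S => T ST; apply: fps_eqmod_sym.
apply: fps_eqmod_trans (powprod_eqmod _) _; apply: fps_eqmod_sym.
apply: (@fps_eqmod_trans _ _ _ (\prod_(i <- T) \prod_(j <- lowlevel d)
    fps_pow (P j) (mu i * A i j))).
  apply: fps_eqmod_prod => i _.
  have -> : \prod_(j <- lowlevel d) fps_pow (P j) (mu i * A i j) =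
      fps_pow (\prod_(j <- lowlevel d) fps_pow (P j) (A i j)) (mu i).
    rewrite fps_pow_prod; last by move=> j; apply/coef0_fps_pow/coef0_factor.
    by apply: eq_bigr => j _; rewrite fps_pow_pow ?coef0_factor // mulrC.
  apply: fps_pow_eqmod; first exact: coef0_powprod.
    by apply: coef0_fps_prod => j; apply/coef0_fps_pow/coef0_factor.
  exact: powprod_eqmod.
rewrite exchange_big /=; apply: fps_eqmod_prod => j jd.
rewrite -fps_pow_sum ?coef0_factor // (fsbigTE T) // => i iT.
apply/eqP; apply: contraNT iT => nz; apply: (fsubsetP ST).
by apply/bigfcupP; exists j; rewrite ?jd // in_fset_set // inE.
Qed.

End Recurrence.

(** * Determinants indexed by a sequence *)

Section SeqDet.
Variables (K : comNzRingType) (T : choiceType).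
Implicit Types (s t : seq T) (F : T -> T -> K).

(** On the enumeration of a finite set this is [fset_det]; sequences allow
    induction on the index set and independence of its enumeration. *)
Definition seq_det s F : K :=
  \det (\matrix_(i < size s, j < size s)
          F (tnth (in_tuple s) i) (tnth (in_tuple s) j)).

Lemma eq_seq_det s F1 F2 : {in s &, F1 =2 F2} -> seq_det s F1 = seq_det s F2.
Proof.
by move=> e; congr (\det _); apply/matrixP => i j; rewrite !mxE e ?mem_tnth.
Qed.

Lemma seq_det_tuple m (u : m.-tuple T) F :
  seq_det u F = \det (\matrix_(i < m, j < m) F (tnth u i) (tnth u j)).
Proof.
case: u => s us /=; have e := eqP us; case: m / e us => us.
by have -> : Tuple us = in_tuple s by apply: val_inj.
Qed.

Lemma perm_seq_det s t F : perm_eq s t -> seq_det s F = seq_det t F.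
Proof.
move=> st; have /tuple_permP [p ->] : perm_eq s (in_tuple t) by [].
rewrite seq_det_tuple /seq_det.
pose M : 'M[K]_(size t) := \matrix_(i, j) F (tnth (in_tuple t) i) (tnth (in_tuple t) j).
have -> : (\matrix_(i, j) F (tnth [tuple tnth (in_tuple t) (p k) | k < size t] i)
      (tnth [tuple tnth (in_tuple t) (p k) | k < size t] j)) =
    row_perm p (col_perm p M).
  by apply/matrixP => i j; rewrite !mxE !tnth_mktuple.
rewrite row_permE col_permE !det_mulmx !det_perm mulrCA odd_permV.
by rewrite -signr_addb addbb mulr1.
Qed.

Lemma seq_det_cons k s F :
    F k k = 1 -> {in s, forall i, F i k = 0} ->
  seq_det (k :: s) F = seq_det s F.
Proof.
move=> Fkk Fk; rewrite /seq_det (expand_det_col _ ord0) big_ord_recl big1.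
  rewrite addr0 !mxE Fkk mul1r /cofactor expr0 mul1r; congr (\det _).
  by apply/matrixP => i j; rewrite !mxE !(tnth_nth k) /=.
move=> i _; rewrite !mxE (tnth_nth k) /= Fk ?mul0r //.
by apply: mem_nth; apply: ltn_ord.
Qed.

Lemma seq_det_cat r s F :
    uniq (r ++ s) -> {in r, forall k i, F i k = (i == k)%:R} ->
  seq_det (r ++ s) F = seq_det s F.
Proof.
elim: r => //= k r IH /andP [kN us] Fr.
rewrite seq_det_cons; first 1 last.
- by rewrite Fr ?inE eqxx.
- move=> i iin; rewrite Fr ?inE ?eqxx //; case: eqP => // ik.
  by rewrite -ik iin in kN.
by apply: IH => // j jr; apply: Fr; rewrite inE jr orbT.
Qed.

(** Trivial columns can be dropped.  This lets the determinants attached to N and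
    to N + e_i, whose supports may differ, be compared on the larger support. *)
Lemma seq_det_fsubset (S S' : {fset T}) F :
    (S `<=` S')%fset -> (forall k i, k \notin S -> F i k = (i == k)%:R) ->
  seq_det S' F = seq_det S F.
Proof.
move=> SS' FS; have p : perm_eq S' ((S' `\` S)%fset ++ S).
  apply: uniq_perm; rewrite ?fset_uniq //.
    rewrite cat_uniq !fset_uniq andbT /=; apply/hasPn => i iS.
    by rewrite /= inE iS.
  move=> i; rewrite mem_cat inE.
  by case: (boolP (i \in S)) => [/(fsubsetP SS') ->|_]; rewrite ?orbF.
rewrite (perm_seq_det _ p) seq_det_cat -?(perm_uniq p) //.
by move=> k; rewrite inE => /andP [kS _] i; rewrite FS.
Qed.

Lemma seq_det_colD s k F F1 F2 : uniq s -> k \in s ->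
    {in s &, forall i j, j != k -> F1 i j = F i j} ->
    {in s &, forall i j, j != k -> F2 i j = F i j} ->
    {in s, forall i, F i k = F1 i k + F2 i k} ->
  seq_det s F = seq_det s F1 + seq_det s F2.
Proof.
move=> us ks e1 e2 e; rewrite /seq_det -det_tr -[X in _ = X + _]det_tr.
rewrite -[X in _ = _ + X]det_tr -[X in _ = X + _]mul1r -[X in _ = _ + X]mul1r.
have ik : (index k s < size s)%N by rewrite index_mem.
pose i0 := Ordinal ik; have i0E : tnth (in_tuple s) i0 = k.
  by rewrite (tnth_nth k) /= nth_index.
have neq j : tnth (in_tuple s) (lift i0 j) != k.
  rewrite -i0E; apply/eqP; rewrite !(tnth_nth k) => /eqP.
  by rewrite nth_uniq // => /eqP/val_inj/eqP; rewrite eq_sym (negPf (neq_lift _ _)).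
apply: (determinant_multilinear (i0 := i0)).
- by apply/matrixP => i j; rewrite !mxE i0E !mul1r e ?mem_tnth.
- by apply/matrixP => i j; rewrite !mxE e1 ?mem_tnth.
- by apply/matrixP => i j; rewrite !mxE e2 ?mem_tnth.
Qed.

Lemma seq_det_scale_col s F (c : T -> K) :
  seq_det s (fun i j => F i j * c j) = seq_det s F * \prod_(i <- s) c i.
Proof.
rewrite big_tnth; pose d : 'rV[K]_(size s) := \row_j c (tnth (in_tuple s) j).
have -> : \prod_(i < size s) c (tnth (in_tuple s) i) = \det (diag_mx d).
  by rewrite det_diag; apply: eq_bigr => i _; rewrite mxE.
rewrite -det_mulmx mul_mx_diag; congr (\det _).
by apply/matrixP => i j; rewrite !mxE.
Qed.

Lemma seq_det_diag s (c : T -> K) : uniq s ->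
  seq_det s (fun i j => (i == j)%:R * c j) = \prod_(i <- s) c i.
Proof.
move=> us; rewrite seq_det_scale_col -[s in seq_det s _]cats0 seq_det_cat //.
  by rewrite /seq_det det_mx00 mul1r.
by rewrite cats0.
Qed.

End SeqDet.

(** * Power series summed over finitely supported exponents *)

Section Series.
Variables (K : numFieldType) (n : nat).
Local Notation fps := (fps K n).
Local Notation qidx := (qidx n).
Local Notation Nvec := (Nvec n).
Implicit Types (N : Nvec) (i j : qidx) (c : Nvec -> K) (mu : qidx -> K)
  (G H : qidx -> qidx -> K).

Definition incr N i : Nvec := [fsfun N with i |-> (N i).+1].

Definition decr N i : Nvec := [fsfun N with i |-> (N i).-1].

Lemma finsupp_incr N i : finsupp (incr N i) = (i |` finsupp N)%fset.
Proof. by rewrite finsupp_with. Qed.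

Lemma incrK N i : decr (incr N i) i = N.
Proof.
apply/fsfunP => j; rewrite !fsfun_withE.
by case: eqVneq => [->|]; rewrite ?eqxx.
Qed.

Lemma decrK N i : N i != 0%N -> incr (decr N i) i = N.
Proof.
move=> Ni; apply/fsfunP => j; rewrite !fsfun_withE.
by case: eqVneq => [->|]; rewrite ?eqxx ?prednK // lt0n.
Qed.

Lemma Nmonom_fsubset N (S : {fset qidx}) : (finsupp N `<=` S)%fset ->
  Nmonom K N = \prod_(i <- S) fpsX K i.1 ^+ (level i * N i).
Proof.
move=> NS; apply: big_fset_incl NS _ => i _ /fsfun_dflt ->.
by rewrite muln0 expr0.
Qed.

Lemma Nmonom_incr N i : Nmonom K (incr N i) = xvar K i * Nmonom K N.
Proof.
have iS : i \in (i |` finsupp N)%fset by rewrite !inE eqxx.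
rewrite (@Nmonom_fsubset N (i |` finsupp N)%fset) ?fsubsetUr //.
rewrite /Nmonom finsupp_incr !(big_fsetD1 i iS) /= mulrA; congr (_ * _).
  by rewrite fsfun_with -exprD mulnS.
apply: eq_big_seq => j; rewrite !inE fsfun_withE.
by case: eqVneq.
Qed.

Lemma Nmonom0 : Nmonom K ([fsfun] : Nvec) = 1.
Proof. by rewrite /Nmonom finsupp0 big_seq_fset0. Qed.

Lemma Nmonom_eqmod0 N i : fps_eqmod (level i * N i) (Nmonom K N) 0.
Proof.
rewrite (@Nmonom_fsubset N (i |` finsupp N)%fset) ?fsubsetUr //.
rewrite (big_fsetD1 i) ?inE ?eqxx //= -[X in fps_eqmod X]addn0.
apply: fps_eqmod0M => //; rewrite fpsXE.
apply: (@fps_eqmod_le K n _ _ _ _ _ (@fpsM_eqmod0 K n _)).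
by rewrite mdegMn mdeg1 mul1n.
Qed.

Lemma Nmonom_coef_neq0 N m i :
  Nmonom K N m != 0 -> (level i * N i <= mdeg m)%N.
Proof. by apply: contra_neqT; rewrite -ltnNge => /(@Nmonom_eqmod0 N i). Qed.

Lemma Nmonom_coef_low N m i :
  Nmonom K N m != 0 -> i \in finsupp N -> i \in lowlevel n (mdeg m).
Proof.
rewrite mem_finsupp in_lowlevel => /(@Nmonom_coef_neq0 _ _ i) le Ni.
by apply: leq_trans le; rewrite leq_pmulr // lt0n.
Qed.

Lemma Nmonom_finite (m : 'X_{1..n}) :
  finite_set [set N : Nvec | Nmonom K N m != 0]%classic.
Proof.
pose S := lowlevel n (mdeg m).
(* All exponents are at most the degree, and the support lies in [lowlevel]. *)
pose toN (f : {ffun S -> 'I_(mdeg m).+1}) : Nvec :=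
  [fsfun x : S => f x : nat | 0%N].
apply: (@sub_finite_set _ _ (toN @` [set: {ffun S -> 'I_(mdeg m).+1}])%classic).
  move=> N /= Nm; exists [ffun x : S => inord (N (val x))] => //.
  apply/fsfunP => i; rewrite fsfun_ffun; case: insubP => [u uS ui|iS] /=.
    rewrite ffunE ui inordK // ltnS.
    by apply: leq_trans (Nmonom_coef_neq0 i Nm); rewrite leq_pmull.
  by rewrite fsfun_dflt //; apply: contra iS; apply: Nmonom_coef_low.
by apply: finite_image; apply: finite_finset.
Qed.

Definition Nseries c : fps := isum (fun N => fpsC n (c N) * Nmonom K N).

Lemma coef_Nseries c m :
  Nseries c m = \sum_(N \in [set: Nvec]%classic) c N * Nmonom K N m.
Proof. by apply: eq_fsbigr => N _; apply: coef_fpsC. Qed.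

Lemma coef_Nseries_fin m : exists s : seq Nvec, forall c,
  Nseries c m = \sum_(N <- s) c N * Nmonom K N m.
Proof.
exists (fset_set [set N : Nvec | Nmonom K N m != 0]%classic) => c.
rewrite coef_Nseries; apply: fsbigTE => N.
rewrite in_fset_set; last exact: Nmonom_finite.
by rewrite notin_setE /= => /negP; rewrite negbK => /eqP ->; rewrite mulr0.
Qed.

Lemma eq_Nseries c1 c2 : c1 =1 c2 -> Nseries c1 = Nseries c2.
Proof. by move=> /funext ->. Qed.

(** Multiplication by [xvar i] turns [Nmonom N] into [Nmonom (incr N i)], so
    reindexing the terms with non-zero [N i] compares the coefficients. *)
Lemma Nseries_rec c c1 c2 i :
    (forall N, N i = 0%N -> c N = c1 N) ->
    (forall N, c (incr N i) = c1 (incr N i) + c2 N) ->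
  Nseries c = Nseries c1 + xvar K i * Nseries c2.
Proof.
move=> c0 cS; apply/fpsP => m; apply/eqP.
rewrite coef_fpsD addrC -subr_eq; apply/eqP.
have -> : (xvar K i * Nseries c2) m =
    \sum_(N \in [set: Nvec]%classic) c2 N * Nmonom K (incr N i) m.
  rewrite /xvar fpsXE coef_fpsM; case: ifP => um.
    rewrite coef_Nseries; apply: eq_fsbigr => N _.
    by rewrite Nmonom_incr /xvar fpsXE coef_fpsM um.
  rewrite fsbig1 // => N _.
  by rewrite Nmonom_incr /xvar fpsXE coef_fpsM um mulr0.
have -> : Nseries c m - Nseries c1 m = Nseries (fun N => c N - c1 N) m.
  have [s sE] := coef_Nseries_fin m; rewrite !sE -sumrB.
  by apply: eq_bigr => N _; rewrite mulrBl.
rewrite coef_Nseries -(@fsbig_widen _ _ _ _ [set N : Nvec | N i != 0%N]%classic) //.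
  rewrite (reindex_fsbig (fun N => incr N i) [set: Nvec]%classic).
    by apply: eq_fsbigr => N _; rewrite cS [c1 _ + _]addrC addrK.
  split.
  - by move=> N _ /=; rewrite fsfun_with.
  - by move=> N N' _ _ e; rewrite -(incrK N i) e incrK.
  - by move=> N /= Ni; exists (decr N i); rewrite ?decrK.
move=> N [_ /= /negP]; rewrite negbK => /eqP Ni.
by rewrite c0 // subrr mul0r.
Qed.

Lemma coef_Nseries_single c m : (forall N, N != [fsfun] -> c N * Nmonom K N m = 0) ->
  Nseries c m = c [fsfun] * (m == 0%MM)%:R.
Proof.
move=> cN; rewrite coef_Nseries (fsbigTE [fset ([fsfun] : Nvec)]%fset).
  by rewrite big_seq_fset1 Nmonom0 coef_fps1.
by move=> N; rewrite inE => /cN.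
Qed.

Lemma Nvec_neq0 N : N != [fsfun] -> exists i, N i != 0%N.
Proof.
move=> NN; apply: contrapT => H; case/eqP: NN; apply/fsfunP => i.
by rewrite fsfun0E; apply/eqP; apply: contrapT => /negP Ni; apply: H; exists i.
Qed.

Lemma coef0_Nseries c : Nseries c 0%MM = c [fsfun].
Proof.
rewrite coef_Nseries_single ?eqxx ?mulr1 // => N /Nvec_neq0 [i Ni].
have -> : Nmonom K N 0%MM = 0; last by rewrite mulr0.
by apply: (@Nmonom_eqmod0 N i); rewrite mdeg0 muln_gt0 !lt0n.
Qed.

Lemma Nseries_eq1 c : c [fsfun] = 1 -> (forall N, N != [fsfun] -> c N = 0) ->
  Nseries c = 1.
Proof.
move=> c1 c0; apply/fpsP => m; rewrite coef_Nseries_single => [|N /c0 ->].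
  by rewrite c1 mul1r coef_fps1.
by rewrite mul0r.
Qed.

(** * The recurrence for the determinantal series *)

(** The number [P_i] of the fermionic formulae, with [mu] in place of [nu D^-1]
    and [G] in place of [G D^-1]. *)
Definition vacancy G mu N i : K :=
  - mu i - \sum_(j \in [set: qidx]%classic) (N j)%:R * G j i.

Lemma vacancy_fsubset G mu N i (S : {fset qidx}) : (finsupp N `<=` S)%fset ->
  vacancy G mu N i = - mu i - \sum_(j <- S) (N j)%:R * G j i.
Proof.
move=> NS; congr (_ - _); apply: fsbigTE => j jS.
by rewrite fsfun_dflt ?mul0r //; apply: contra jS; apply: (fsubsetP NS).
Qed.

(** The numbers [P_j] depend on mu and N only through [mu + N G]. *)
Lemma vacancy_incr G mu N i j :
  vacancy G mu (incr N i) j = vacancy G (fun j => mu j + G i j) N j.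
Proof.
have iS : i \in (i |` finsupp N)%fset by rewrite !inE eqxx.
rewrite !(@vacancy_fsubset _ _ _ _ (i |` finsupp N)%fset) ?finsupp_incr ?fsubsetUr //.
rewrite !(big_fsetD1 i iS) /= fsfun_with -natr1.
have -> : \sum_(k <- ((i |` finsupp N) `\ i)%fset) (incr N i k)%:R * G k j =
    \sum_(k <- ((i |` finsupp N) `\ i)%fset) (N k)%:R * G k j.
  apply: eq_big_seq => k; rewrite !inE fsfun_withE.
  by case: eqVneq.
by ring.
Qed.

Lemma vacancy_shift G mu N i t j :
  vacancy G (shift mu i t) N j = vacancy G mu N j - (if j == i then t else 0).
Proof. by rewrite /vacancy /shift; ring. Qed.

(** In the determinant of the series, column j has the diagonal contribution
    [diagcoef] and is otherwise [offcoef] times column j of a constant matrix [H].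
    Taking [s = 0], [H = 0] gives K, and [s = -1], [H = G] gives R.  As
    [diagcoef] is 1 and [offcoef] is 0 for [k = 0], the columns outside the
    support of N are trivial. *)
Definition diagcoef (s p : K) (k : nat) : K := cbinom (p + k%:R + s) k.

Definition offcoef (s p : K) (k : nat) : K :=
  if k is k'.+1 then cbinom (p + k%:R + s) k' else 0.

Lemma diagcoefS s p k : diagcoef s p k.+1 = diagcoef s (p - 1) k.+1 + diagcoef s p k.
Proof.
rewrite /diagcoef -natr1.
have -> : p + (k%:R + 1) + s = p + k%:R + s + 1 by ring.
by rewrite cbinomS; congr (cbinom _ _ + _); ring.
Qed.

Lemma offcoefS s p k : offcoef s p k.+1 = offcoef s (p - 1) k.+1 + offcoef s p k.
Proof.
case: k => [|k] /=; first by rewrite !cbinom0 addr0.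
rewrite -natr1; have -> : p + (k.+1%:R + 1) + s = p + k.+1%:R + s + 1 by ring.
by rewrite cbinomS; congr (cbinom _ _ + _); ring.
Qed.

Definition colmx s G H mu N i j : K :=
  (i == j)%:R * diagcoef s (vacancy G mu N j) (N j)
  + H i j * offcoef s (vacancy G mu N j) (N j).

Definition detcoef s G H mu N : K := seq_det (finsupp N) (colmx s G H mu N).

Lemma detcoef_fsubset s G H mu N (S : {fset qidx}) : (finsupp N `<=` S)%fset ->
  detcoef s G H mu N = seq_det S (colmx s G H mu N).
Proof.
move=> NS; rewrite (seq_det_fsubset NS) // => k i /fsfun_dflt Nk.
by rewrite /colmx Nk /diagcoef /offcoef cbinom0 mulr1 mulr0 addr0.
Qed.

(** Passing from mu to mu + e_i lowers [vacancy] at i by 1 and leaves the other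
    columns unchanged, so the recurrence is Pascal's rule in column i, where
    [diagcoef] and [offcoef] both satisfy it. *)
Lemma detcoef_recursive s G H :
  recursive_family G (fun mu => Nseries (detcoef s G H mu)).
Proof.
split.
- move=> mu i; apply: Nseries_rec => N.
    move=> Ni; apply: eq_seq_det => j k _ kN.
    have ki : k != i by apply: contraTneq kN => ->; rewrite mem_finsupp Ni.
    by rewrite /colmx vacancy_shift (negPf ki) subr0.
  have sub : (finsupp (incr N i) `<=` i |` finsupp N)%fset.
    by rewrite finsupp_incr.
  rewrite !(detcoef_fsubset _ _ _ _ sub).
  rewrite (@detcoef_fsubset _ _ _ _ N (i |` finsupp N)%fset) ?fsubsetUr //.
  apply: (@seq_det_colD _ _ _ i); rewrite ?fset_uniq ?inE ?eqxx //.
  - move=> j k _ _ ki; by rewrite /colmx vacancy_shift (negPf ki) subr0.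
  - move=> j k _ _ ki.
    by rewrite /colmx -vacancy_incr fsfun_withE (negPf ki).
  move=> j _; rewrite /colmx vacancy_shift eqxx -!vacancy_incr fsfun_with.
  by rewrite diagcoefS offcoefS; ring.
- move=> mu i m; have [r rE] := coef_Nseries_fin m.
  apply: (eq_polyfun (fun t => esym (rE _))).
  apply: polyfun_sum => N; apply: polyfunM; last exact: polyfunC.
  apply: polyfun_det => j k.
  pose x := tnth (in_tuple (finsupp N)) j; pose y := tnth (in_tuple (finsupp N)) k.
  apply: (eq_polyfun (h1 := fun t =>
    (x == y)%:R * diagcoef s (vacancy G mu N y - (if y == i then t else 0)) (N y)
    + H x y * offcoef s (vacancy G mu N y - (if y == i then t else 0)) (N y))).
    by move=> t; rewrite mxE /colmx vacancy_shift.
  have vP : polyfun (fun t => vacancy G mu N y - (if y == i then t else 0)).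
    apply: polyfunB; first exact: polyfunC.
    by case: (y == i); [exact: polyfun_id | exact: polyfunC].
  have cP b : polyfun (fun t =>
      cbinom (vacancy G mu N y - (if y == i then t else 0) + (N y)%:R + s) b).
    apply: (polyfun_comp (polyfun_cbinom _ b)).
    by do 2![apply: polyfunD; last exact: polyfunC].
  apply: polyfunD; apply: polyfunM; try exact: polyfunC; first exact: cP.
  rewrite /offcoef; case: (N y) (cP (N y).-1) => // _; exact: polyfunC.
move=> d; exists (lowlevel n d) => mu mu' e m md.
rewrite !coef_Nseries; apply: eq_fsbigr => N _.
have [->|Nm] := eqVneq (Nmonom K N m) 0; first by rewrite !mulr0.
congr (_ * _); apply: eq_seq_det => j k _ kN.
rewrite /colmx /vacancy e //; have := Nmonom_coef_low Nm kN.
by rewrite !in_lowlevel => /leq_trans; apply; apply: ltnW.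
Qed.

End Series.

(** * The fermionic series as determinantal series *)

Section Fermionic.
Variables (K : numFieldType) (n : nat).
Local Notation fps := (fps K n).
Local Notation qidx := (qidx n).
Local Notation Nvec := (Nvec n).
Implicit Types (N : Nvec) (i j : qidx) (mu nu : qidx -> K)
  (D Dinv G : qidx -> qidx -> K) (Q : qidx -> fps).

Lemma cbinomS_absorb (t : K) k : cbinom t k.+1 = (t - k%:R) / k.+1%:R * cbinom t k.
Proof.
rewrite /cbinom big_ord_recr factS natrM /=; set P := \prod_(_ < _) _.
have k1 : (k.+1%:R : K) != 0 by rewrite pnatr_eq0.
have kf : ((k`!)%:R : K) != 0 by rewrite pnatr_eq0 -lt0n fact_gt0.
by rewrite -natr1 in k1 *; field; rewrite k1 kf.
Qed.

(** This is [Fmx], with [mu] and [G] in place of [nu D^-1] and [G D^-1]. *)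
Definition fermionic_mx G mu N i j : K :=
  (i == j)%:R * vacancy G mu N j + G i j * (N j)%:R.

(** The factors of R are absorbed into the columns: for k > 0,
    [p/k * binom(p+k-1, k-1) = binom(p+k-1, k)]. *)
Lemma detcoef_fermionic_mx G mu N :
  detcoef (-1) G G mu N = seq_det (finsupp N) (fermionic_mx G mu N) *
    \prod_(i <- finsupp N)
      ((N i)%:R^-1 * cbinom (vacancy G mu N i + (N i)%:R - 1) (N i).-1).
Proof.
rewrite -seq_det_scale_col; apply: eq_seq_det => i j _; rewrite mem_finsupp.
rewrite /colmx /fermionic_mx /diagcoef /offcoef; case: (N j) => // k _ /=.
have k1 : (k.+1%:R : K) != 0 by rewrite pnatr_eq0.
rewrite cbinomS_absorb -natr1 in k1 *.
by field; rewrite k1.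
Qed.

(** N itself is a left null vector: the j-th entry of [N F] is
    [N_j (vacancy_j + sum_i N_i G_ij)], that is [- N_j mu_j], which is 0. *)
Lemma seq_det_fermionic_mx0 G N : N != [fsfun] ->
  seq_det (finsupp N) (fermionic_mx G (fun=> 0) N) = 0.
Proof.
move=> /Nvec_neq0 [i Ni]; apply/eqP/det0P.
pose tn := tnth (in_tuple (finsupp N)).
exists (\row_k (N (tn k))%:R).
  have := Ni; rewrite -mem_finsupp => /(tnthP (in_tuple _)) [k iE].
  apply/eqP => /rowP /(_ k); rewrite !mxE /tn -iE => /eqP.
  by rewrite pnatr_eq0 (negPf Ni).
apply/rowP => k; rewrite !mxE; set j := tn k.
have jN : j \in finsupp N by apply: mem_tnth.
transitivity (\sum_(i <- finsupp N) (N i)%:R * fermionic_mx G (fun=> 0) N i j).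
  by rewrite [RHS]big_tnth; apply: eq_bigr => l _; rewrite !mxE.
rewrite /fermionic_mx; under eq_bigr do rewrite mulrDr.
rewrite big_split /= (big_fsetD1 j) //= eqxx mul1r big1_seq ?addr0; last first.
  by move=> l; rewrite !inE => /andP [_ /andP [/negPf -> _]]; rewrite mul0r mulr0.
under eq_bigr do rewrite mulrA.
rewrite -mulr_suml mulrC -mulrDl (@vacancy_fsubset _ _ _ _ _ _ (finsupp N)) //.
by rewrite oppr0 sub0r addNr mul0r.
Qed.

Lemma Nseries_fermionic0 G : Nseries (detcoef (-1) G G (fun=> 0)) = 1 :> fps.
Proof.
apply: Nseries_eq1 => [|N NN].
  by rewrite /detcoef finsupp0 /seq_det det_mx00.
by rewrite detcoef_fermionic_mx seq_det_fermionic_mx0 ?mul0r.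
Qed.

(** The vector [nu D^-1] of exponents of the [P_j]. *)
Definition exponent Dinv nu i : K :=
  \sum_(j \in [set: qidx]%classic) nu j * Dinv j i.

Lemma Kseries_det Dinv G nu : Kseries Dinv G nu =
  Nseries (detcoef 0 (imul G Dinv) (fun=> fun=> 0) (exponent Dinv nu)).
Proof.
rewrite /Kseries -/(Nseries _); apply: eq_Nseries => N.
rewrite -seq_det_diag ?fset_uniq //; apply: eq_seq_det => i j _ _.
by rewrite /colmx mul0r addr0 /diagcoef addr0.
Qed.

Lemma Rseries_det Dinv G nu : Rseries Dinv G nu =
  Nseries (detcoef (-1) (imul G Dinv) (imul G Dinv) (exponent Dinv nu)).
Proof.
rewrite /Rseries -/(Nseries _); apply: eq_Nseries => N.
by rewrite detcoef_fermionic_mx.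
Qed.

Lemma exponent0 Dinv : exponent Dinv (fun=> 0) = fun=> 0.
Proof.
by apply/funext => i; rewrite /exponent fsbig1 // => j _; rewrite mul0r.
Qed.

(** * The canonical solution *)

Definition Dprod D Q i : fps := iprod (fun j => fps_pow (Q j) (D i j)).

(** The second term of the i-th equation is a multiple of [xvar i]. *)
Lemma Dprod_eqmod1 D G Q : Qsolution D G Q ->
  forall i, fps_eqmod (level i) (Dprod D Q i) 1.
Proof.
move=> [_ sol] i m mi; have [_ _ <-] := sol i.
rewrite coef_fpsD; set g := iprod (fun j => fps_pow (Q j) (G i j)).
have -> : (fpsX K i.1 ^+ level i * g) m = 0; last by rewrite addr0.
have g0 : fps_eqmod 0 g 0 by [].
by apply: (fps_eqmod0M (@xvar_eqmod0 K n i) g0); rewrite addn0.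
Qed.

(** Taking powers commutes with the convergent product defining [Dprod], which
    turns the inner products of the canonical condition into powers of [Dprod]. *)
Lemma canonical_powprod D Dinv G Q : Qsolution D G Q -> Qcanonical D Dinv Q ->
  forall i, Q i = powprod (Dprod D Q) (Dinv i).
Proof.
move=> [Q1 sol] can i; have [_ /iprodE <-] := can i.
rewrite /powprod; congr iprod; apply/funext => j; apply: iprodE.
have [/iprod_cvgP cvD _ _] := sol j.
have -> : (fun l => fps_pow (Q l) (Dinv i j * D j l)) =
    (fun l => fps_pow (fps_pow (Q l) (D j l)) (Dinv i j)).
  by apply/funext => l; rewrite fps_pow_pow // mulrC.
exact: iprod_to_pow (fun l => coef0_fps_pow (D j l) (Q1 l)) cvD.
Qed.

Lemma iprod_to_canonical D Dinv G Q nu :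
    Qsolution D G Q -> Qcanonical D Dinv Q -> nu_admissible Dinv nu ->
  iprod_to (fun i => fps_pow (Q i) (nu i))
    (powprod (Dprod D Q) (exponent Dinv nu)).
Proof.
move=> sol can adm; have QE := canonical_powprod sol can.
have -> : (fun i => fps_pow (Q i) (nu i)) =
    (fun i => fps_pow (powprod (Dprod D Q) (Dinv i)) (nu i)).
  by apply/funext => i; rewrite -QE.
exact: (iprod_to_powprod (Dprod_eqmod1 sol) adm).
Qed.

Lemma Dprod_equation D Dinv G Q i :
    imul_wd G Dinv -> Qsolution D G Q -> Qcanonical D Dinv Q ->
  Dprod D Q i = 1 - xvar K i * powprod (Dprod D Q) (imul G Dinv i).
Proof.
move=> wd sol can; have [_ /(_ i) [_ _ eq1]] := sol.
rewrite -(iprodE (iprod_to_canonical sol can (wd i))).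
by apply/eqP; rewrite eq_sym subr_eq; apply/eqP; rewrite -eq1.
Qed.

Lemma Qnu_fermionic D Dinv G Q nu :
    imul_wd G Dinv -> Qsolution D G Q -> Qcanonical D Dinv Q ->
    nu_admissible Dinv nu ->
  [/\ iprod_cvg (fun i => fps_pow (Q i) (nu i)),
      Kseries Dinv G (fun=> 0) \is a GRing.unit,
      Qnu Q nu = Kseries Dinv G nu / Kseries Dinv G (fun=> 0) &
      Kseries Dinv G nu / Kseries Dinv G (fun=> 0) = Rseries Dinv G nu].
Proof.
move=> wd sol can adm; have toP := iprod_to_canonical sol can adm.
have P1 := Dprod_eqmod1 sol.
have Prec := powprod_recursive P1 (fun i => Dprod_equation i wd sol can).
have Kunit : Kseries Dinv G (fun=> 0) \is a GRing.unit.
  apply: fps_unit1; rewrite Kseries_det coef0_Nseries /detcoef finsupp0.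
  by rewrite /seq_det det_mx00.
have KE : Kseries Dinv G nu =
    powprod (Dprod D Q) (exponent Dinv nu) * Kseries Dinv G (fun=> 0).
  rewrite !Kseries_det exponent0.
  exact: recursive_family_unique (detcoef_recursive _ _ _) Prec (powprod0 P1).
have RE : Rseries Dinv G nu = powprod (Dprod D Q) (exponent Dinv nu).
  rewrite Rseries_det (recursive_family_unique _ (detcoef_recursive _ _ _) Prec
    (powprod0 P1)).
  by rewrite Nseries_fermionic0 mulr1.
split; first by exists (powprod (Dprod D Q) (exponent Dinv nu)).
- exact: Kunit.
- rewrite KE (mulrK Kunit); exact: iprodE toP.
- by rewrite KE (mulrK Kunit) RE.
Qed.

End Fermionic.

Theorem theorem4p3 (R : realType) (n : nat) (hn : (0 < n)%N)
    (D Dinv G : qidx n -> qidx n -> R[i])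
    (hD : iinverse D Dinv)
    (hG : imul_wd G Dinv)
    (Q : qidx n -> fps R[i] n)
    (hsol : Qsolution D G Q)
    (hcan : Qcanonical D Dinv Q)
    (nu : qidx n -> R[i])
    (hnu : nu_admissible Dinv nu) :
  [/\ iprod_cvg (fun i => fps_pow (Q i) (nu i)),
      Kseries Dinv G (fun=> 0) \is a GRing.unit,
      Qnu Q nu = Kseries Dinv G nu / Kseries Dinv G (fun=> 0) &
      Kseries Dinv G nu / Kseries Dinv G (fun=> 0) = Rseries Dinv G nu].
Proof. exact: Qnu_fermionic hG hsol hcan hnu. Qed.
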